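(* A perfect cuboid exists if and only if there exist rational numbers $\xi,\zeta\in\mathbb{Q}\setminus\{0,1,-1\}$ with $\xi\neq\zeta$ such that all three of the following are squares of rational numbers: $$\xi\zeta,\qquad (1-\xi^2)(1-\zeta^2),\qquad (1-\xi^2)(1-\zeta^2)+4\xi\zeta .$$
   Context: A perfect cuboid is a rectangular box whose three edges $a,b,c$, three face diagonals $d_{ab}=\sqrt{a^2+b^2}$, $d_{bc}=\sqrt{b^2+c^2}$, $d_{ac}=\sqrt{a^2+c^2}$ and space diagonal $d_s=\sqrt{a^2+b^2+c^2}$ are all rational (equivalently, after scaling, all integers), with $a,b,c$ nonzero. *)

(* Defs.v *)
From HB Require Import structures.
From mathcomp Require Import all_boot all_order all_algebra.
From mathcomp Require Import boolp classical_sets reals.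

Set Implicit Arguments.
Unset Strict Implicit.
Unset Printing Implicit Defensive.

Import Order.TTheory GRing.Theory Num.Theory.

Local Open Scope ring_scope.

(* The edges range over the reals; their rationality is part of the
   definition. They are only required to be nonzero: replacing an edge by its
   opposite changes neither the diagonals nor rationality. *)
Definition perfect_cuboid (R : realType) (a b c : R) : Prop :=
  [/\ a != 0, b != 0 & c != 0] /\
  [/\ rational a, rational b & rational c] /\
  [/\ rational (Num.sqrt (a ^+ 2 + b ^+ 2)),
      rational (Num.sqrt (b ^+ 2 + c ^+ 2)) &
      rational (Num.sqrt (a ^+ 2 + c ^+ 2))] /\
  rational (Num.sqrt (a ^+ 2 + b ^+ 2 + c ^+ 2)).

Definition rat_square (x : rat) : Prop := exists q : rat, x = q ^+ 2.

(* Main.v *)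
(** If xi zeta = p^2, (1 - xi^2)(1 - zeta^2) = q^2 and q^2 + 4p^2 = r^2, the box
    with edges xi - zeta, 2p, q is perfect: its remaining diagonals are
    xi + zeta, 1 - xi zeta and 1 + xi zeta. Conversely, for a perfect cuboid
    with edges a, b, c, face diagonals u = d_ab, v = d_ac and space diagonal s,
    rescaling so that s + v = 2 forces xi + zeta = u and xi - zeta = a, that is
    xi = (u + a) / (s + v) and zeta = (u - a) / (s + v). *)
Require Import Defs.
From HB Require Import structures.
From mathcomp Require Import all_boot all_order all_algebra.
From mathcomp Require Import boolp classical_sets reals.
From mathcomp Require Import ring.

Set Implicit Arguments.
Unset Strict Implicit.
Unset Printing Implicit Defensive.

Import Order.TTheory GRing.Theory Num.Theory.

Local Open Scope ring_scope.

(** The sign condition matters: [Num.sqrt] is 0 on negative numbers, so a negative [x] would have a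
    rational root without being a square. *)
Lemma rational_sqrt_ratr (R : realType) (x : rat) : 0 <= x ->
  rational (Num.sqrt (ratr x : R)) <-> rat_square x.
Proof.
move=> x_ge0; split=> [[q _ def_q]|[q ->]].
  exists q; apply: (fmorph_inj (ratr : {rmorphism rat -> R})).
  by rewrite rmorphXn /= def_q sqr_sqrtr ?ler0q.
by exists `|q| => //; rewrite rmorphXn /= sqrtr_sqr ratr_norm.
Qed.

(** Transfers the problem from [R] to [rat], where all the algebra takes place. *)
Lemma perfect_cuboid_ratr (R : realType) (a b c : rat) :
  perfect_cuboid (ratr a : R) (ratr b) (ratr c) <->
  [/\ a != 0, b != 0 & c != 0] /\
  [/\ rat_square (a ^+ 2 + b ^+ 2), rat_square (b ^+ 2 + c ^+ 2) &
      rat_square (a ^+ 2 + c ^+ 2)] /\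
  rat_square (a ^+ 2 + b ^+ 2 + c ^+ 2).
Proof.
rewrite /perfect_cuboid !fmorph_eq0 -!rmorphXn -!rmorphD /=.
have sqD (x y : rat) : 0 <= x ^+ 2 + y ^+ 2 by rewrite addr_ge0 ?sqr_ge0.
have sqD3 : 0 <= a ^+ 2 + b ^+ 2 + c ^+ 2 by rewrite addr_ge0 ?sqr_ge0.
split=> [[nz [_ [[/(rational_sqrt_ratr R (sqD _ _)) ?
   /(rational_sqrt_ratr R (sqD _ _)) ? /(rational_sqrt_ratr R (sqD _ _)) ?]
   /(rational_sqrt_ratr R sqD3) ?]]] //|[nz [[? ? ?] ?]]].
split=> //; split; first by split; [exists a|exists b|exists c].
by split; [split|]; apply/rational_sqrt_ratr.
Qed.

Lemma cuboid_of_squares (R : realType) (xi zeta : rat) :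
    xi != 0 -> xi != 1 -> xi != -1 -> zeta != 0 -> zeta != 1 -> zeta != -1 ->
    xi != zeta ->
    rat_square (xi * zeta) ->
    rat_square ((1 - xi ^+ 2) * (1 - zeta ^+ 2)) ->
    rat_square ((1 - xi ^+ 2) * (1 - zeta ^+ 2) + 4 * (xi * zeta)) ->
  exists a b c : R, perfect_cuboid a b c.
Proof.
move=> xi0 xi1 xiN1 zeta0 zeta1 zetaN1 neq [p def_p] [q def_q] [r def_r].
(* Excluding 1 and -1 keeps the edge [q] from vanishing. *)
have sqr_neq1 (x : rat) : x != 1 -> x != -1 -> 1 - x ^+ 2 != 0.
  by move=> x1 xN1; rewrite subr_eq0 eq_sym sqrf_eq1 negb_or x1.
have p0 : p != 0 by rewrite -sqrf_eq0 -def_p mulf_neq0.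
have q0 : q != 0 by rewrite -sqrf_eq0 -def_q mulf_neq0 // sqr_neq1.
exists (ratr (xi - zeta)), (ratr (2 * p)), (ratr q).
have p2 : (2 * p) ^+ 2 = 4 * (xi * zeta) by rewrite def_p; ring.
apply/perfect_cuboid_ratr; rewrite p2 -def_q.
split; first by rewrite subr_eq0 mulf_neq0.
split; first split.
- by exists (xi + zeta); ring.
- by exists r; rewrite -def_r; ring.
(* Rests on (xi - zeta)^2 + (1 - xi^2)(1 - zeta^2) = (1 - xi zeta)^2; adding 4 xi zeta then gives
   the space diagonal. *)
- by exists (1 - xi * zeta); ring.
- by exists (1 + xi * zeta); ring.
Qed.

Lemma squares_of_cuboid (a b c : rat) :
    a != 0 -> b != 0 -> c != 0 ->
    rat_square (a ^+ 2 + b ^+ 2) -> rat_square (b ^+ 2 + c ^+ 2) ->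
    rat_square (a ^+ 2 + c ^+ 2) -> rat_square (a ^+ 2 + b ^+ 2 + c ^+ 2) ->
  exists xi zeta : rat,
     [/\ xi != 0, xi != 1 & xi != -1] /\
     [/\ zeta != 0, zeta != 1 & zeta != -1] /\
     xi != zeta /\
     [/\ rat_square (xi * zeta),
         rat_square ((1 - xi ^+ 2) * (1 - zeta ^+ 2)) &
         rat_square ((1 - xi ^+ 2) * (1 - zeta ^+ 2) + 4 * (xi * zeta))].
Proof.
move=> a0 b0 c0 [u def_u] [r def_r] [v def_v] [s def_s].
(* The roots [s] and [v] have unknown signs; this factorization and [b != 0] still make [s + v] a
   legitimate denominator. *)
have b2 : (s + v) * (s - v) = b ^+ 2.
  by rewrite mulrC -subr_sqr -def_s -def_v; ring.
have sv0 : s + v != 0.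
  by apply: contraNneq b0 => sv0; rewrite -sqrf_eq0 -b2 sv0 mul0r.
pose xi := (u + a) / (s + v); pose zeta := (u - a) / (s + v).
have prodE : xi * zeta = (b / (s + v)) ^+ 2.
  have -> : xi * zeta = (u ^+ 2 - a ^+ 2) / (s + v) ^+ 2.
    by rewrite /xi /zeta; field.
  by rewrite -def_u addrC addKr expr_div_n.
have subE : xi - zeta = 2 * a / (s + v) by rewrite /xi /zeta; field.
(* By [b2], the product xi zeta equals (s - v) / (s + v). *)
have sub1E : 1 - xi * zeta = 2 * v / (s + v).
  by rewrite prodE expr_div_n -b2; field.
have sqE : (1 - xi ^+ 2) * (1 - zeta ^+ 2) = (2 * c / (s + v)) ^+ 2.
  have -> : (1 - xi ^+ 2) * (1 - zeta ^+ 2) =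
      (1 - xi * zeta) ^+ 2 - (xi - zeta) ^+ 2 by ring.
  have -> : (2 * c / (s + v)) ^+ 2 =
      4 * ((a ^+ 2 + c ^+ 2) - a ^+ 2) / (s + v) ^+ 2 by field.
  by rewrite sub1E subE def_v; field.
(* Two nonvanishing products yield all the excluded values 0, 1, -1 at once, for both parameters. *)
have prod0 : xi * zeta != 0 by rewrite prodE sqrf_eq0 mulf_neq0 ?invr_eq0.
have sq0 : (1 - xi ^+ 2) * (1 - zeta ^+ 2) != 0.
  by rewrite sqE sqrf_eq0 !mulf_neq0 ?invr_eq0.
have neq_pm1 (x : rat) : 1 - x ^+ 2 != 0 -> x != 1 /\ x != -1.
  by rewrite subr_eq0 eq_sym sqrf_eq1 negb_or => /andP[].
move: prod0 sq0; rewrite (mulf_eq0 xi) (mulf_eq0 (1 - _)) !negb_or.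
move=> /andP[xi0 zeta0] /andP[/neq_pm1[xi1 xiN1] /neq_pm1[zeta1 zetaN1]].
exists xi, zeta; do 2![split=> //]; split.
  by rewrite -subr_eq0 subE !mulf_neq0 ?invr_eq0.
split; first by exists (b / (s + v)).
  by exists (2 * c / (s + v)).
(* Up to the factor 4 / (s + v)^2, the sum is c^2 + b^2 = r^2, the remaining face diagonal. *)
exists (2 * r / (s + v)); rewrite sqE prodE.
have -> : (2 * r / (s + v)) ^+ 2 = 4 * r ^+ 2 / (s + v) ^+ 2 by field.
by rewrite -def_r; field.
Qed.

Theorem theorem1 (R : realType) :
  (exists a b c : R, perfect_cuboid a b c) <->
  (exists xi zeta : rat,
     [/\ xi != 0, xi != 1 & xi != -1] /\
     [/\ zeta != 0, zeta != 1 & zeta != -1] /\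
     xi != zeta /\
     [/\ rat_square (xi * zeta),
         rat_square ((1 - xi ^+ 2) * (1 - zeta ^+ 2)) &
         rat_square ((1 - xi ^+ 2) * (1 - zeta ^+ 2) + 4 * (xi * zeta))]).
Proof.
split=> [[x [y [z cuboid]]]|].
  have [_ [[[a _ def_x] [b _ def_y] [c _ def_z]] _]] := cuboid.
  move: cuboid; rewrite -def_x -def_y -def_z.
  by move=> /perfect_cuboid_ratr[[? ? ?] [[? ? ?] ?]]; apply: (@squares_of_cuboid a b c).
move=> [xi [zeta [[? ? ?] [[? ? ?] [? [? ? ?]]]]]].
exact: (@cuboid_of_squares R xi zeta).
Qed.
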